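(* Let $m\geq 2$ and $n\geq 1$ denote integers. There are examples of proper isometric immersions $F:\mathbb H^m\to\mathbb R^n$, but no such $F$ can be strongly proper; that is, proper isometric immersions of hyperbolic spaces into Euclidean spaces exist, and, whatever $m$ and $n$ are, no proper isometric immersion $F:\mathbb H^m\to\mathbb R^n$ is strongly proper.
   Context: $\mathbb H^m$ is hyperbolic $m$-space, the complete simply-connected $m$-dimensional Riemannian manifold of constant sectional curvature $-1$. An isometric immersion $F:\mathbb H^m\to\mathbb R^n$ is an immersion that pulls back the Euclidean metric to the metric of $\mathbb H^m$. A continuous map is proper if preimages of compact sets are compact. A map $G:M\to N$ between non-compact complete Riemannian manifolds, with $d$ denoting Riemannian distance, is called strongly proper if, for every pair of sequences $(x_l)$, $(y_l)$ in $M$, one has the implication: if $d(x_l,y_l)\to\infty$ as $l\to\infty$, then $\liminf_{l\to\infty} d(G(x_l),G(y_l))>0$. The existence assertion does not claim examples for every pair $(m,n)$; the examples referred to are the proper isometric embeddings $\mathbb H^m\hookrightarrow\mathbb R^{6m-6}$ of Henke and Nettekoven. *)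

(* Defs.v *)
From HB Require Import structures.
From mathcomp Require Import all_boot all_order all_algebra.
From mathcomp Require Import all_classical all_reals all_analysis.
Set Implicit Arguments.
Unset Strict Implicit.
Unset Printing Implicit Defensive.
Import Order.TTheory GRing.Theory Num.Theory.
Import numFieldNormedType.Exports.
Local Open Scope classical_set_scope.
Local Open Scope ring_scope.

(* A Riemannian manifold covered by one global chart: an open subset [dom] of
   a finite-dimensional space [carrier], whose tangent space at a point [p] is
   identified with [carrier] and endowed with the inner product [metric p].
   A map between two such manifolds is represented by a total function between
   the carriers, of which only the values on [dom] are meaningful.  The structure
   records the data only; it is meant for the two instances below.  The norm of
   [carrier] (a sup norm in the instances below) is used only for its topology
   and differential structure. *)
Structure riemannian_chart (R : realType) := RiemannianChart {
  carrier :> normedModType R;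
  dom : set carrier;
  metric : carrier -> carrier -> carrier -> R
}.
Arguments dom {R} _ _.
Arguments metric {R} _ _ _ _.

Definition dotv (R : realType) (n : nat) (u v : 'rV[R]_n) : R :=
  \sum_(i < n) u 0 i * v 0 i.

Definition euclidean (R : realType) (n : nat) : riemannian_chart R :=
  @RiemannianChart R 'rV[R]_n [set: 'rV[R]_n] (fun _ u v => dotv u v).

(* The upper half-space model of hyperbolic m-space, for 1 <= m: points
   (x, y) with x in R^(m-1) and 0 < y, and metric (|dx|^2 + dy^2) / y^2. *)
Definition hyperbolic (R : realType) (m : nat) : riemannian_chart R :=
  @RiemannianChart R ('rV[R]_m.-1 * R)%type [set p | 0 < p.2]
    (fun p u v => (dotv u.1 v.1 + u.2 * v.2) / p.2 ^+ 2).

Section Distance.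
Variables (R : realType) (M : riemannian_chart R).

Definition curve_length (gamma : R -> M) : \bar R :=
  (\int[lebesgue_measure]_(t in `[0%R, 1%R])
    (Num.sqrt (metric M (gamma t) (derive1 gamma t) (derive1 gamma t)))%:E)%E.

(* A C^1 curve on [0, 1] extends to a C^1 function on R, which is only required
   to take values in [dom M] on [0, 1].  Piecewise C^1 curves would give the same distance: each becomes
   C^1, with the same length, once reparametrized so as to stop at its
   corners. *)
Definition C1_curve (x y : M) (gamma : R -> M) : Prop :=
  [/\ forall t : R, derivable gamma t 1,
      continuous (derive1 gamma),
      forall t : R, 0 <= t <= 1 -> dom M (gamma t),
      gamma 0 = x & gamma 1 = y].

Definition riemannian_dist (x y : M) : \bar R :=
  ereal_inf [set curve_length gamma | gamma in C1_curve x y].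

End Distance.

Fixpoint class_C (R : realType) (V W : normedModType R) (k : nat) (U : set V)
    (F : V -> W) : Prop :=
  if k is k'.+1 then
    (forall x, U x -> differentiable F x) /\
    (forall v, class_C k' U (fun x => 'd F x v))
  else forall x, U x -> {for x, continuous F}.

Section Maps.
Variables (R : realType) (M N : riemannian_chart R).

Definition smooth_map (F : M -> N) : Prop :=
  (forall x, dom M x -> dom N (F x)) /\ forall k, class_C k (dom M) F.

Definition isometric_immersion (F : M -> N) : Prop :=
  [/\ smooth_map F,
      forall x, dom M x -> injective ('d F x : M -> N)
    & forall x, dom M x -> forall u v : M,
        metric N (F x) ('d F x u) ('d F x v) = metric M x u v].

Definition proper_map (F : M -> N) : Prop :=
  (forall x, dom M x -> {for x, continuous F}) /\
  forall K : set N, K `<=` dom N -> compact K ->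
    compact (dom M `&` F @^-1` K).

Definition strongly_proper (G : M -> N) : Prop :=
  forall x y : nat -> M,
    (forall l, dom M (x l)) -> (forall l, dom M (y l)) ->
    riemannian_dist (x l) (y l) @[l --> \oo] --> +oo%E ->
    (0 < limn_einf (fun l => riemannian_dist (G (x l)) (G (y l))))%E.

End Maps.

(* Main.v *)
Require Import Defs.
From HB Require Import structures.
From mathcomp Require Import all_boot all_order all_algebra.
From mathcomp Require Import all_classical all_reals all_analysis.
From mathcomp Require Import ring lra.
Set Implicit Arguments.
Unset Strict Implicit.
Unset Printing Implicit Defensive.
Import Order.TTheory GRing.Theory Num.Theory.
Import numFieldNormedType.Exports.
Local Open Scope classical_set_scope.
Local Open Scope ring_scope.

(* Existence.  Following Blanusa, the hyperbolic plane, written as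
   ds^2 / (1 + s^2) + (1 + s^2) dw^2 with s = x / y and w = ln (x^2 + y^2) / 2, is
   immersed in R^6 by
     (X(s), w, a0/c0 cos(c0 w), a0/c0 sin(c0 w), a1/c1 cos(c1 w), a1/c1 sin(c1 w))
   where a0(s)^2 + a1(s)^2 = s^2 and the frequencies c0(s), c1(s) are step
   functions which only jump where the corresponding amplitude vanishes identically
   and which grow fast enough for (a0'/c0)^2 + (a1'/c1)^2 to stay below half of
   1 / (1 + s^2); the primitive X supplies the rest of the ds^2 term.  As the metric
   (|dx|^2 + dy^2) / y^2 on R^(m-1) x R_+ is the sum over j < m-1 of the metrics
   (dx_j^2 + dy^2 / (m-1)) / y^2, which are those of rescaled hyperbolic planes,
   the product of m-1 such maps is an immersion of H^m in R^(6(m-1)).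

   Obstruction.  The points (k 2^t, 1), k < 2^s, of a horocycle are pairwise at a
   distance tending to infinity with t, yet within O(s + t) of each other: climb to
   height 2^(s+t), move horizontally, come down.  An isometric immersion does not
   increase distances, so their 2^s images lie in a cube of side O(s + t) of R^n, and
   for s large two of them are arbitrarily close. *)

(** * Calculus of functions of class C^k *)

Section ClassC.
Context {R : realType}.
Implicit Types V W : normedModType R.

(** The first-order expansion of [f] at [x] only sees values near [x], and uniqueness of the
    differential does the rest. *)
Lemma near_eq_is_diff V W (f g df : V -> W) x :
  (\forall y \near x, f y = g y) -> is_diff x f df -> is_diff x g df.
Proof.
move=> fg [dfx <-].
have cdf : continuous ('d f x : V -> W) by exact: diff_continuous.
have gE : g \o shift x = cst (g x) + 'd f x +o_ 0 id.
  apply/eqaddoP => _/posnumP[e].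
  have /eqaddoP/(_ e%:num (gt0 e)) := diff_locally dfx.
  have fg0 : \forall y \near (0 : V), f (y + x) = g (y + x).
    by move: fg; rewrite (near_shift 0 x); apply: filterS => y; rewrite /= subr0.
  apply: filterS2 fg0 => y; rewrite /= !fctE /= => <-.
  by rewrite (nbhs_singleton fg).
split; last exact: diff_unique.
by apply/diff_locallyP; rewrite (diff_unique cdf gE).
Qed.

Lemma class_CW V W k (U : set V) (F : V -> W) : class_C k.+1 U F -> class_C k U F.
Proof.
elim: k F => [|k IH] F [dF cF].
  by move=> x Ux; apply: differentiable_continuous; exact: dF.
by split => // v; apply: IH; exact: cF.
Qed.

Lemma class_C_le V W j k (U : set V) (F : V -> W) :
  (j <= k)%N -> class_C k U F -> class_C j U F.
Proof.
elim: k => [|k IH]; first by rewrite leqn0 => /eqP ->.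
by rewrite leq_eqVlt => /predU1P[->//|]; rewrite ltnS => jk /class_CW/IH; apply.
Qed.

Lemma class_CS V W k (U : set V) (F : V -> W) : class_C k U F ->
  forall U', U' `<=` U -> class_C k U' F.
Proof.
elim: k F => [|k IH] F /= CF U' U'U; first by move=> x /U'U; exact: CF.
split => [x /U'U|v]; first exact: CF.1.
by apply: IH => //; exact: CF.2.
Qed.

(** Designed for functions built from step frequencies, which coincide near each point with a smooth
    [G] depending on that point. The induction works because agreement near [x] is agreement near
    every [y] close to [x], so the differentials of [F] and [G] also agree near [x]. *)
Lemma class_C_local V W k (U : set V) (F : V -> W) : open U ->
  (forall x, U x -> exists2 G, class_C k U G & \forall y \near x, F y = G y) ->
  class_C k U F.
Proof.
move=> oU; elim: k F => [|k IH] F FG.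
  move=> x Ux; have [G CG FGx] := FG x Ux.
  rewrite /prop_for /continuous_at (nbhs_singleton FGx); apply: cvg_trans (CG x Ux).
  by apply: near_eq_cvg; exact: filterS FGx.
have key x : U x -> exists2 G, class_C k.+1 U G &
     \forall y \near x, is_diff y F ('d G y).
  move=> Ux; have [G CG FGx] := FG x Ux; exists G => //.
  apply: filterS2 (near_join FGx) (open_nbhs_nbhs (conj oU Ux)) => y FGy Uy.
  apply: (@near_eq_is_diff _ _ G); first by apply: filterS FGy => z ->.
  by apply: differentiableP; exact: CG.1.
split => [x Ux|v].
  by have [G _ /nbhs_singleton[]] := key x Ux.
apply: IH => x Ux; have [G CG FGx] := key x Ux.
exists (fun y => 'd G y v); first exact: CG.2.
by apply: filterS FGx => y dF; rewrite diff_val.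
Qed.

Lemma class_C_eq V W k (U : set V) (F G : V -> W) : open U ->
  (forall x, U x -> F x = G x) -> class_C k U G -> class_C k U F.
Proof.
move=> oU FG CG; apply: class_C_local => // x Ux; exists G => //.
by apply: filterS (open_nbhs_nbhs (conj oU Ux)) => y; exact: FG.
Qed.

Lemma class_C_cst V W k (U : set V) (a : W) : class_C k U (fun=> a).
Proof.
elim: k a => [|k IH] a; first by move=> x _; exact: cvg_cst.
split => [x _|v]; first exact: differentiable_cst.
have -> : (fun x => 'd (fun=> a) x v) = (fun=> 0); last exact: IH.
by apply/funext => x; rewrite -/(cst a) diff_cst.
Qed.

Lemma class_C_linear V W k (U : set V) (f : {linear V -> W}) :
  continuous f -> class_C k U f.
Proof.
case: k => [|k] cf; first by move=> x _; exact: cf.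
split => [x _|v]; first exact: linear_differentiable.
have -> : (fun x => 'd f x v) = (fun=> f v); last exact: class_C_cst.
by apply/funext => x; rewrite diff_lin.
Qed.

Lemma class_C_id V k (U : set V) : class_C k U (fun x => x).
Proof. by apply: (@class_C_linear _ _ _ _ idfun) => x; exact: cvg_id. Qed.

Lemma class_CD V W k (U : set V) (f g : V -> W) : open U ->
  class_C k U f -> class_C k U g -> class_C k U (fun x => f x + g x).
Proof.
move=> oU; elim: k f g => [|k IH] f g.
  by move=> cf cg x Ux; apply: cvgD; [exact: cf|exact: cg].
move=> [df Df] [dg Dg]; split => [x Ux|v].
  by apply: (@differentiableD _ _ _ f g); auto.
apply: (@class_C_eq _ _ _ _ _ (fun x => 'd f x v + 'd g x v)) => // [x Ux|].
  have := @diffD _ _ _ f g x (df x Ux) (dg x Ux).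
  by move/(congr1 (fun h => h v)).
exact: IH (Df v) (Dg v).
Qed.

Lemma class_CZl V W k (U : set V) (f : V -> R) (e : W) : open U ->
  class_C k U f -> class_C k U (fun x => f x *: e).
Proof.
move=> oU; elim: k f => [|k IH] f.
  by move=> cf x Ux; apply: cvgZr_tmp; exact: cf.
move=> [df Cf]; split => [x Ux|v].
  by apply: differentiableZl; auto.
apply: (@class_C_eq _ _ _ _ _ (fun x => 'd f x v *: e)) => // [x Ux|].
  by rewrite diffZl//; exact: df.
exact: IH (Cf v).
Qed.

Lemma class_CM V k (U : set V) (f g : V -> R) : open U ->
  class_C k U f -> class_C k U g -> class_C k U (fun x => f x * g x).
Proof.
move=> oU; elim: k f g => [|k IH] f g.
  by move=> cf cg x Ux; apply: cvgM; [exact: cf|exact: cg].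
move=> Cf Cg; have [df Df] := Cf; have [dg Dg] := Cg; split => [x Ux|v].
  by apply: (@differentiableM _ _ f g); auto.
apply: (@class_C_eq _ _ _ _ _ (fun x => f x * 'd g x v + g x * 'd f x v)) => // [x Ux|].
  have := @diffM _ _ f g x (df x Ux) (dg x Ux).
  by move/(congr1 (fun h => h v)).
apply: class_CD => //; first exact: IH (class_CW Cf) (Dg v).
exact: IH (class_CW Cg) (Df v).
Qed.

Lemma class_CN V k (U : set V) (f : V -> R) : open U ->
  class_C k U f -> class_C k U (fun x => - f x).
Proof.
move=> oU Cf; have := class_CM oU (class_C_cst k U (-1 : R)) Cf.
by under eq_fun do rewrite mulN1r.
Qed.

Lemma class_C_sum V W k (U : set V) n (f : 'I_n -> V -> W) : open U ->
  (forall i, class_C k U (f i)) -> class_C k U (fun x => \sum_(i < n) f i x).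
Proof.
move=> oU; elim: n f => [|n IH] f Cf.
  by under eq_fun do rewrite big_ord0; exact: class_C_cst.
by under eq_fun do rewrite big_ord_recr/=; apply: class_CD => //; exact: IH.
Qed.

Lemma class_C_row V k (U : set V) n (f : V -> 'rV[R]_n) : open U ->
  (forall i, class_C k U (fun x => f x 0 i)) -> class_C k U f.
Proof.
move=> oU Cf.
have -> : f = (fun x => \sum_(i < n) f x 0 i *: delta_mx 0 i).
  by apply/funext => x; exact: row_sum_delta.
by apply: class_C_sum => // i; exact: class_CZl.
Qed.

Lemma class_C_comp V k (U : set V) (D : set R) (h : R -> R) (f : V -> R) :
  open U -> (forall x, U x -> D (f x)) ->
  class_C k D h -> class_C k U f -> class_C k U (fun x => h (f x)).
Proof.
move=> oU UD; elim: k h f UD => [|k IH] h f UD Ch Cf.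
  by move=> x Ux; apply: (cvg_comp f h (Cf x Ux)); exact: Ch (UD _ Ux).
have [dh Dh] := Ch; have [df Df] := Cf; split => [x Ux|v].
  by apply: (@differentiable_comp _ _ _ _ f h); auto.
apply: (@class_C_eq _ _ _ _ _ (fun x => 'd h (f x) 1 * 'd f x v)) => // [x Ux|].
  have := @diff_comp _ _ _ _ f h x (df x Ux) (dh _ (UD x Ux)).
  move/(congr1 (fun g => g v)) => /= ->.
  by rewrite -[X in 'd h _ X]mulr1 linearZ mulrC.
apply: class_CM => //; last exact: Df.
exact: IH UD (Dh 1) (class_CW Cf).
Qed.

(** Bootstraps smoothness of one-variable functions whose derivative is expressed through functions
    already known to be of class [k], often the function itself, as for the inverse, the square root
    and [flat]. *)
Lemma class_C1 k (D : set R) (h h' : R -> R) : open D ->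
  (forall x, D x -> is_derive x 1 h (h' x)) -> class_C k D h' ->
  class_C k.+1 D h.
Proof.
move=> oD hh' Ch'; split => [x Dx|v].
  by apply/derivable1_diffP; have [] := hh' _ Dx.
apply: (@class_C_eq _ _ _ _ _ (fun x => v * h' x)) => // [x Dx|].
  have [dh <-] := hh' _ Dx.
  by rewrite deriv1E// derive1E.
by apply: class_CM => //; exact: class_C_cst.
Qed.

Lemma class_C_derive1 k (D : set R) (h : R -> R) :
  open D -> class_C k.+1 D h -> class_C k D (derive1 h).
Proof.
move=> oD [dh Dh]; apply: class_C_eq (Dh 1) => // x Dx.
by rewrite derive1E'; last exact: dh.
Qed.

End ClassC.

(** * Smooth functions of one variable *)

Section SmoothFunctions.
Context {R : realType}.
Implicit Types (k n : nat) (x t : R).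
Local Notation mu := (@lebesgue_measure R).
Local Notation pos := [set x : R | 0 < x].

Let open_pos : open pos := @open_gt R 0.

Lemma class_C_sin_cos k (U : set R) : class_C k U (@sin R) /\ class_C k U (@cos R).
Proof.
suff [H1 H2] : class_C k [set: R] (@sin R) /\ class_C k [set: R] (@cos R).
  by split; [move: H1|move: H2] => /class_CS; apply.
elim: k => [|k [IHs IHc]].
  by split => x _; [exact: continuous_sin|exact: continuous_cos].
split; first by apply: class_C1 IHc => //; exact: openT.
apply: (@class_C1 _ _ _ _ (fun x => - sin x)); first exact: openT.
by apply: class_CN => //; exact: openT.
Qed.

Lemma is_derive_inv x : x != 0 -> is_derive x 1 (fun y : R => y^-1) (- x ^- 2).
Proof.
move=> x0; apply: DeriveDef; first exact: derivableV.
by rewrite deriveV// derive_id /GRing.scale/= mulr1.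
Qed.

Lemma class_C_inv k : class_C k pos (fun x : R => x^-1).
Proof.
elim: k => [|k IH]; first by move=> x /= x0; apply: inv_continuous; rewrite gt_eqF.
apply: (@class_C1 _ _ _ _ (fun x => - (x^-1 * x^-1))) => // [x x0|].
  by rewrite -expr2 exprVn; apply: is_derive_inv; rewrite gt_eqF.
by apply: class_CN => //; exact: class_CM.
Qed.

Lemma class_C_ln k : class_C k pos (@ln R).
Proof.
by apply: class_CW; apply: class_C1 (class_C_inv k).
Qed.

Lemma class_C_sqrt k : class_C k pos (@Num.sqrt R).
Proof.
elim: k => [|k IH]; first by move=> x _; exact: sqrt_continuous.
apply: (@class_C1 _ _ _ _ (fun x => (2 * Num.sqrt x)^-1)) => //.
apply: (class_C_comp open_pos _ (class_C_inv k)) => [x x0|].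
  by rewrite /= mulr_gt0// sqrtr_gt0.
by apply: class_CM => //; exact: class_C_cst.
Qed.

(* [flat 0] is the standard smooth function vanishing exactly on the nonpositive
   reals; the family [flat n] is stable under derivation. *)
Definition flat n x := if 0 < x then x^-1 ^+ n * expR (- x^-1) else 0.

Lemma flat_le n x : 0 <= flat n x <= n.+1`!%:R * `|x|.
Proof.
rewrite /flat; case: ifPn => x0; last by rewrite lexx mulr_ge0.
rewrite mulr_ge0 ?exprn_ge0 ?invr_ge0 ?(ltW x0) ?expR_ge0//= gtr0_norm//.
have := @expR_ge1Dxn _ x^-1 n; rewrite invr_ge0 (ltW x0) => /(_ isT) H.
have {}H : x^-1 ^+ n.+1 / n.+1`!%:R <= expR x^-1 by apply: le_trans H; rewrite lerDr.
rewrite ler_pdivrMr ?ltr0n ?fact_gt0// in H.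
rewrite expRN ler_pdivrMr ?expR_gt0//.
have -> : x^-1 ^+ n = x * x^-1 ^+ n.+1 by rewrite exprS mulrA mulfV ?mul1r// gt_eqF.
by rewrite -mulrA mulrCA ler_pM2l// mulrC.
Qed.

Lemma is_derive_flat n x :
  is_derive x 1 (flat n) (flat n.+2 x - n%:R * flat n.+1 x).
Proof.
have [x0|x0|->] := ltgtP x 0.
- rewrite /flat !ltNge (ltW x0)/= mulr0 subr0.
  apply: (@near_eq_is_derive _ _ _ (cst 0)).
  by near=> y; rewrite ltNge ltW//; near: y; exact: lt_nbhsl.
- rewrite /flat x0.
  have x0' : x != 0 by rewrite gt_eqF.
  have di := is_derive_inv x0'.
  have de : is_derive x 1 (fun y => expR (- y^-1)) (x ^- 2 * expR (- x^-1)).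
    have dNi := is_deriveN di; apply: is_derive_eq (is_derive1_comp _ dNi) _.
    by rewrite opprK mulrC.
  have dX := is_deriveX n di.
  have fE : \forall y \near x, ((fun y => y^-1) ^+ n * (fun y => expR (- y^-1))) y = flat n y.
    by near=> y; rewrite /flat ifT ?fctE//; near: y; exact: lt_nbhsr.
  apply: is_derive_eq (near_eq_is_derive fE (is_deriveM dX de)) _.
  rewrite /GRing.scale/= !fctE -exprVn; case: n {dX fE} => [|n] /=; first by ring.
  by rewrite !exprS; ring.
(* At the origin the slope function of [flat n] is exactly [flat n.+1], which tends to 0 by
   [flat_le]. *)
- apply/is_derive1_caratheodory; exists (flat n.+1); split.
  + move=> z; rewrite subr0 /flat ltxx subr0.
    case: ifPn => z0; last by rewrite mul0r.
    by rewrite exprS mulrAC -mulrA mulrACA mulVf ?mul1r// gt_eqF.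
  + have f0 : flat n.+1 0 = 0 by rewrite /flat ltxx.
    rewrite /prop_for /continuous_at f0; apply/cvgr0Pnorm_le => /= e e0.
    near=> z; have /andP[z0 H] := flat_le n.+1 z.
    rewrite ger0_norm//; apply: le_trans H _.
    rewrite -ler_pdivlMl ?ltr0n ?fact_gt0//.
    rewrite -normrN -sub0r; near: z; apply: cvgr_dist_le; first exact: cvg_id.
    by rewrite mulr_gt0// invr_gt0 ltr0n fact_gt0.
  + by rewrite /flat ltxx mulr0 subr0.
Unshelve. all: by end_near. Qed.

Lemma class_C_flat k n (U : set R) : class_C k U (flat n).
Proof.
suff : class_C k [set: R] (flat n) by move/class_CS; apply.
elim: k n => [|k IH] n.
  move=> x _; apply/differentiable_continuous/derivable1_diffP.
  by have [] := is_derive_flat n x.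
apply: class_C1; [exact: openT|by move=> x _; exact: is_derive_flat|].
apply: class_CD; [exact: openT|exact: IH|].
apply: class_CN; first exact: openT.
by apply: class_CM; [exact: openT|exact: class_C_cst|exact: IH].
Qed.

Lemma exists_antiderivative (f : R -> R) : continuous f ->
  exists F : R -> R, forall x, is_derive x 1 F (f x).
Proof.
move=> cf.
have fi a b : mu.-integrable `[a, b] (EFin \o f).
  apply: continuous_compact_integrable; first exact: segment_compact.
  exact: continuous_subspaceT.
pose J a x := (\int[mu]_(t in `[a, x]) f t)%R.
have JB a b x : a <= b -> b <= x -> J a x - J a b = J b x.
  move=> ab bx; rewrite /J Rintegral_itvB//.
  by rewrite Rintegral_itv_obnd_cbnd//; apply: integrableS (fi b x) => //;
    exact: subset_itv_oc_cc.
(* The fundamental theorem is applied on segments with a fixed left end, so the base point is put to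
   the left of both [x] and 0. Subtracting the integral up to 0 makes the value independent of this
   base point, which is [FE]. *)
pose F x := J (- (`|x| + 1)) x - J (- (`|x| + 1)) 0.
have FE a x : a <= - (`|x| + 1) -> F x = J a x - J a 0.
  move=> ax; have [x1 x2] : - (`|x| + 1) <= x /\ - (`|x| + 1) <= 0.
    have := ler_norm (- x); have := normr_ge0 x; rewrite normrN; lra.
  by rewrite /F -(JB a _ x)// -(JB a _ 0)//; lra.
exists F => x.
(* A base point that is admissible for all [y] within 1 of [x]. *)
pose a := - (`|x| + 2).
have [] := @continuous_FTC1_closed _ f a x (x + 1) _ (fi _ _) _ (cf x).
- by rewrite ltrDl.
- have := ler_norm (- x); rewrite normrN /a; lra.
rewrite -/(J a) derive1E => dJ DJ.
have dF : is_derive x 1 (fun y => J a y - J a 0) (f x).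
  by rewrite -[f x]subr0; apply: is_deriveB; exact: DeriveDef.
apply: near_eq_is_derive dF; near=> y; apply/esym/FE.
rewrite lerN2 -/a.
suff : `|y| <= `|x| + 1 by rewrite /a; lra.
rewrite addrC -lerBlDr; apply: le_trans (lerB_dist _ _) _.
by rewrite distrC; near: y; apply: cvgr_dist_le; [exact: cvg_id|exact: ltr01].
Unshelve. all: by end_near. Qed.

End SmoothFunctions.

(** * Amplitudes and step frequencies *)

Section Profile.
Context {R : realType}.
Implicit Types (k : nat) (n : int) (s t : R) (a c : R -> R).

Lemma cos_2pi_int n : cos (pi *+ 2 * n%:~R) = 1 :> R.
Proof.
have cos_nat m : cos (pi *+ 2 * m%:R) = 1 :> R.
  elim: m => [|m IH]; first by rewrite mulr0 cos0.
  by rewrite -natr1 mulrDr mulr1 cosD2pi.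
case: n => m; first exact: cos_nat.
by rewrite NegzE mulrNz mulrN cosN cos_nat.
Qed.

(** A partition of unity in the sense of squares, multiplied by [s]. The bump [b 1] vanishes where
    [cos (2 pi s) <= -1/2], around half-integers, and [b (-1)] where [cos (2 pi s) >= 1/2], around
    integers. They never vanish together, so [N > 0] and both can be divided by its square root. *)
Lemma exists_profile : exists a0 a1 : R -> R,
  [/\ forall k, class_C k [set: R] a0 /\ class_C k [set: R] a1,
      forall s, a0 s ^+ 2 + a1 s ^+ 2 = s ^+ 2,
      forall n, \forall s \near (n%:~R - 2^-1 : R), a0 s = 0
    & forall n, \forall s \near (n%:~R : R), a1 s = 0].
Proof.
pose b (e s : R) := flat 0 (2^-1 + e * cos (pi *+ 2 * s)).
pose N s := b 1 s ^+ 2 + b (-1) s ^+ 2.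
have oT : open [set: R] := openT.
have cid k := class_C_id k [set: R].
have ccos k : class_C k [set: R] (fun s => cos (pi *+ 2 * s)).
  apply: (@class_C_comp _ _ _ _ setT) => //; first exact: (class_C_sin_cos _ _).2.
  by apply: class_CM => //; exact: class_C_cst.
have cb e k : class_C k [set: R] (b e).
  apply: (@class_C_comp _ _ _ _ setT) => //; first exact: class_C_flat.
  apply: class_CD => //; first exact: class_C_cst.
  by apply: class_CM => //; exact: class_C_cst.
have b_gt0 e s : 0 < 2^-1 + e * cos (pi *+ 2 * s) -> 0 < b e s.
  by move=> h; rewrite /b /flat h mulr_gt0 ?expR_gt0// expr0.
have N_gt0 s : 0 < N s.
  have [h|h] := ltP (0 : R) (cos (pi *+ 2 * s)).
    by rewrite ltr_pwDl ?sqr_ge0// exprn_gt0// b_gt0//; lra.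
  by rewrite ltr_pwDr ?sqr_ge0// exprn_gt0// b_gt0//; lra.
have cN k : class_C k [set: R] N.
  by apply: class_CD => //; apply: class_CM.
have ca e k : class_C k [set: R] (fun s => s * (b e s * (Num.sqrt (N s))^-1)).
  apply: class_CM; [exact: oT|exact: cid|].
  apply: class_CM => //.
  have cs : class_C k [set: R] (fun s => Num.sqrt (N s)).
    by apply: (@class_C_comp _ _ _ _ [set x | 0 < x]) (class_C_sqrt k) (cN k) => // x _; exact: N_gt0.
  apply: (@class_C_comp _ _ _ _ [set x | 0 < x] (fun x => x^-1)) (class_C_inv k) cs => // x _.
  by rewrite /= sqrtr_gt0.
have b0 e s0 : e * cos (pi *+ 2 * s0) = -1 -> \forall s \near s0, b e s = 0.
  move=> h.
  have cc : {for s0, continuous (fun s => 2^-1 + e * cos (pi *+ 2 * s))}.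
    have : class_C 0 [set: R] (fun s => 2^-1 + e * cos (pi *+ 2 * s)).
      apply: class_CD => //; first exact: class_C_cst.
      by apply: class_CM => //; exact: class_C_cst.
    by apply.
  near=> s; rewrite /b /flat ifF//; apply/negbTE; rewrite -leNgt ltW//.
  near: s; apply: (cvgr_lt _ cc).
  by rewrite h; lra.
exists (fun s => s * (b 1 s * (Num.sqrt (N s))^-1)).
exists (fun s => s * (b (-1) s * (Num.sqrt (N s))^-1)); split => //.
- move=> s; rewrite !exprMn -mulrDr -mulrDl -/(N s) exprVn sqr_sqrtr ?ltW//.
  by rewrite mulfV ?mulr1// gt_eqF.
- move=> n; have : 1 * cos (pi *+ 2 * (n%:~R - 2^-1)) = -1 :> R.
    rewrite mul1r -[LHS]opprK -cosDpi; congr (- _).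
    by rewrite -[RHS](cos_2pi_int n); congr cos; field.
  by move/b0; apply: filterS => s ->; rewrite mul0r mulr0.
- move=> n; have : -1 * cos (pi *+ 2 * n%:~R) = -1 :> R by rewrite cos_2pi_int mulr1.
  by move/b0; apply: filterS => s ->; rewrite mul0r mulr0.
Unshelve. all: by end_near. Qed.

(** This local alternative is what makes [a / c] times an oscillation of frequency [c] smooth
    despite the jumps of [c]. *)
Definition tame a c := (forall k, class_C k [set: R] a) /\
  forall s, (\forall t \near s, a t = 0) \/ (\forall t \near s, c t = c s).

Lemma near_floor (x : R) : (forall n, x != n%:~R) ->
  \forall y \near x, Num.floor y = Num.floor x.
Proof.
move=> xn; near=> y; apply/floor_def/andP; split.
  apply/ltW; near: y; apply: lt_nbhsr.
  by rewrite lt_neqAle eq_sym xn floor_le.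
by near: y; apply: lt_nbhsl; exact: floorD1_gt.
Unshelve. all: by end_near. Qed.

(** On each interval [[n - e, n + 1 - e)] take for [c] the constant [max (1, max h)]; then
    [h <= c <= c ^+ 2] since [c >= 1]. The jumps occur at the points [n - e], where [a] vanishes
    nearby. The factor 4 gives [(a' / c) ^+ 2] at most a quarter of [1 / (1 + s ^+ 2)], so that two
    amplitudes together use at most half of it. *)
Lemma exists_frequency (e : R) a : (forall k, class_C k [set: R] a) ->
  (forall n, \forall s \near (n%:~R - e : R), a s = 0) ->
  exists c, [/\ forall s, 1 <= c s,
    forall s, 4 * (1 + s ^+ 2) * derive1 a s ^+ 2 <= c s ^+ 2 & tame a c].
Proof.
move=> Ca a0; pose h s := 4 * (1 + s ^+ 2) * derive1 a s ^+ 2.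
have ch : continuous h.
  have oT : open [set: R] := openT.
  have cid := class_C_id 0 [set: R].
  have ca' : class_C 0 [set: R] (derive1 a) by exact: class_C_derive1.
  have : class_C 0 [set: R] h.
    apply: class_CM; [by []| |exact: class_CM].
    apply: class_CM; [by []|exact: class_C_cst|].
    by apply: class_CD; [by []|exact: class_C_cst|exact: class_CM].
  by move=> H x; exact: H.
have /choice[M hM] n : exists M : R, 1 <= M /\
    forall s, n%:~R - e <= s <= n%:~R + 1 - e -> h s <= M.
  have [||x _ xM] := @EVT_max R h (n%:~R - e) (n%:~R + 1 - e).
  - lra.
  - exact: continuous_subspaceT.
  exists (Num.max 1 (h x)); split; first by rewrite le_max lexx.
  by move=> s sn; rewrite le_max xM ?orbT// in_itv.
exists (fun s => M (Num.floor (s + e))); split => [s|s|].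
- exact: (hM _).1.
- have [M1 hs] := hM (Num.floor (s + e)).
  apply: (@le_trans _ _ (M (Num.floor (s + e)))).
    apply: hs; have /andP[] := floor_itv (s + e); rewrite intrD.
    by move=> ? ?; apply/andP; split; lra.
  by rewrite expr2 ler_peMr// (le_trans _ M1).
split => // s; have [[n sn]|sn] := pselect (exists n, s + e = n%:~R).
  by left; have -> : s = n%:~R - e by [lra|exact: a0].
right; have /near_floor : forall n, s + e != n%:~R.
  by move=> n; apply/eqP => sen; apply: sn; exists n.
rewrite (near_shift s (s + e)) /=.
by apply: filterS => t /=; rewrite (addrC s) addrK => ->.
Qed.

Lemma is_derive_diff (f : R -> R) (x f' : R) :
  is_derive x 1 f f' -> is_diff x f (fun h => h * f').
Proof.
move=> [df <-]; split; first exact/derivable1_diffP.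
by rewrite deriv1E// derive1E.
Qed.

Lemma is_diff_comp1 (V : normedModType R) (z : V) (S dS : V -> R) (f : R -> R) (f' : R) :
  is_diff z S dS -> is_derive (S z) 1 f f' ->
  is_diff z (fun y => f (S y)) (fun v => dS v * f').
Proof.
move=> dSz /is_derive_diff df.
exact: is_diff_comp dSz df.
Qed.

Lemma class_C_derivable k a s : class_C k.+1 [set: R] a ->
  is_derive s 1 a (derive1 a s).
Proof.
move=> [da _]; rewrite derive1E; apply: derivableP; apply/derivable1_diffP; exact: da.
Qed.

(** * Oscillations with a tame amplitude and frequency *)

Section Tame.
Variables a c : R -> R.
Hypothesis (ac : tame a c).

Lemma tame_near0 s : (\forall t \near s, a t = 0) -> a s = 0 /\ derive1 a s = 0.
Proof.
move=> a0; split; first exact: nbhs_singleton a0.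
rewrite derive1E (near_eq_derive _ (g := cst 0)) ?derive_cst//.
Qed.

Lemma class_C_tame k : class_C k [set: R] (fun s => derive1 a s / c s).
Proof.
have oT : open [set: R] := openT.
apply: class_C_local => // s _; have [/near_join a0|cs] := ac.2 s.
  exists (fun=> 0); first exact: class_C_cst.
  by apply: filterS a0 => t /tame_near0[_ ->]; rewrite mul0r.
exists (fun t => derive1 a t / c s); last by apply: filterS cs => t ->.
apply: class_CM => //; last exact: class_C_cst.
by apply: class_C_derive1 => //; exact: ac.1.
Qed.

Variables (V : normedModType R).

Lemma class_C_tame_comp k (U : set V) (S W : V -> R) (h : R -> R) : open U ->
  class_C k [set: R] h -> class_C k U S -> class_C k U W ->
  class_C k U (fun z => a (S z) / c (S z) * h (c (S z) * W z)).
Proof.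
move=> oU Ch CS CW; apply: class_C_local => // z Uz.
have cS : {for z, continuous S} by apply: (class_C_le (leq0n k) CS).
have [/cS a0|/cS cs] := ac.2 (S z).
  exists (fun=> 0); first exact: class_C_cst.
  by apply: filterS (a0 : \forall y \near z, a (S y) = 0) => t /= ->; rewrite !mul0r.
exists (fun y => a (S y) / c (S z) * h (c (S z) * W y)); last first.
  by apply: filterS (cs : \forall y \near z, c (S y) = c (S z)) => t /= ->.
apply: class_CM => //.
  apply: class_CM => //; last exact: class_C_cst.
  by apply: (@class_C_comp _ _ _ _ setT) => //; exact: ac.1.
apply: (@class_C_comp _ _ _ _ setT) => //.
by apply: class_CM => //; exact: class_C_cst.
Qed.

(** The frequency differentiates like a constant: it is one near [S z], or else [a] vanishes there
    and both terms are 0. The factor [c] coming out of [h] cancels [1 / c], which leaves the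
    amplitude [a] itself in front of [dW]. *)
Lemma is_diff_tame_comp (z : V) (S W dS dW : V -> R) (h : R -> R) (h' : R) :
  c (S z) != 0 ->
  is_diff z S dS -> is_diff z W dW -> is_derive (c (S z) * W z) 1 h h' ->
  is_diff z (fun y => a (S y) / c (S y) * h (c (S y) * W y))
    (fun v => derive1 a (S z) / c (S z) * h (c (S z) * W z) * dS v
              + a (S z) * h' * dW v).
Proof.
move=> c0 dSz dWz dh.
have cS : {for z, continuous S} by apply: differentiable_continuous.
have [a0'|/cS cs] := ac.2 (S z).
  have /cS a0 := a0'.
  have [-> ->] := tame_near0 a0'.
  apply: (@near_eq_is_diff _ _ _ (cst 0)).
    by apply: filterS (a0 : \forall y \near z, a (S y) = 0) => t /= ->; rewrite !mul0r.
  apply: is_diff_eq; apply/funext => v /=.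
  by rewrite !mul0r addr0.
apply: (@near_eq_is_diff _ _ _ (fun y => a (S y) / c (S z) * h (c (S z) * W y))).
  by apply: filterS (cs : \forall y \near z, c (S y) = c (S z)) => t /= ->.
have d1 := is_diff_comp1 dSz (class_C_derivable (S z) (ac.1 1%N)).
have d2 : is_diff z (fun y => c (S z) * W y) (fun v => c (S z) * dW v).
  exact: is_diffZ.
have d3 : is_diff z (fun y => h (c (S z) * W y)) (fun v => c (S z) * dW v * h').
  exact: is_diff_comp1 d2 dh.
have d4 : is_diff z (fun y => (c (S z))^-1 * (a (S y) * h (c (S z) * W y))) (fun v => (c (S z))^-1 *
  (a (S z) * (c (S z) * dW v * h') + h (c (S z) * W z) * (dS v * derive1 a (S z)))).
  apply: is_diffZ; exact: is_diffM d1 d3.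
have -> : (fun y => a (S y) / c (S z) * h (c (S z) * W y)) =
   (fun y => (c (S z))^-1 * (a (S y) * h (c (S z) * W y))).
  by apply/funext => y; ring.
apply: is_diff_eq; apply/funext => v.
by field.
Qed.

End Tame.

End Profile.

(** * Blanusa's immersion of the plane *)

Section Plane.
Context {R : realType}.
Implicit Types (k : nat) (s t w x y : R).

(** The function [2 * Y t - ln (1 + t)] is nondecreasing on the nonnegative reals. Applied to the
    primitive [X], this turns a bound on the first coordinate into a bound on [s], hence
    properness. *)
Lemma ln_growth (Y Y' : R -> R) : (forall s, is_derive s 1 Y (Y' s)) ->
  (forall s, 0 <= s -> (2 * (1 + s))^-1 <= Y' s) ->
  forall s, 0 <= s -> s <= expR (2 * (Y s - Y 0)).
Proof.
move=> dY Y'_ge s s0.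
have dln t : 0 <= t -> is_derive t 1 (fun t => ln (1 + t)) (1 + t)^-1.
  move=> t0; have t1 : 0 < 1 + t by rewrite ltr_pwDl.
  have d1 : is_derive t 1 (fun t : R => 1 + t) 1.
    by have := is_deriveD (is_derive_cst (1 : R) t 1) (is_derive_id t 1); rewrite add0r.
  by have := is_derive1_comp (is_derive1_ln t1) d1; rewrite mulr1.
pose f t := 2 * Y t - ln (1 + t).
have df t : 0 <= t -> is_derive t 1 f (2 * Y' t - (1 + t)^-1).
  by move=> /dln d; apply: is_deriveB; exact: is_deriveZ.
have [||t ts fE] := @MVT_segment _ f (fun t => 2 * Y' t - (1 + t)^-1) 0 s s0.
- by move=> t; rewrite in_itv/= => /andP[t0 _]; apply: df; exact: ltW.
- apply: continuous_in_subspaceT => t; rewrite inE/= in_itv/= => /andP[t0 _].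
  by apply/differentiable_continuous/derivable1_diffP; have [] := df t t0.
have t0 : 0 <= t by move: ts; rewrite in_itv/= => /andP[].
have : 0 <= f s - f 0.
  rewrite fE subr0 mulr_ge0// subr_ge0.
  have := Y'_ge t t0; rewrite invfM => /(ler_wpM2l (ler0n _ 2)).
  by rewrite mulrA mulfV ?mul1r.
rewrite /f addr0 ln1 subr0 => h.
apply: (@le_trans _ _ (1 + s)); first by rewrite lerDr.
rewrite -[leLHS]lnK ?posrE ?ltr_pwDl// ler_expR; lra.
Qed.

(** The first two clauses are stated for [g r (S z) (W z)] with arbitrary [S] and [W], so that
    half-space coordinates can be substituted directly. The third says that the differential [dg]
    pulls the Euclidean product back to the hyperbolic metric in the coordinates [(s, w)], and the
    last is a quantitative form of properness. *)
Lemma exists_plane_immersion : exists (g : 'I_6 -> R -> R -> R)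
    (dg : 'I_6 -> R -> R -> R -> R -> R),
  [/\ forall (V : normedModType R) (U : set V) (S W : V -> R) k r, open U ->
        class_C k U S -> class_C k U W -> class_C k U (fun z => g r (S z) (W z)),
      forall (V : normedModType R) (z : V) (S W dS dW : V -> R) r,
        is_diff z S dS -> is_diff z W dW ->
        is_diff z (fun p => g r (S p) (W p))
          (fun v => dg r (S z) (W z) (dS v) (dW v)),
      forall s w x y x' y', \sum_(r < 6) dg r s w x y * dg r s w x' y' =
        x * x' / (1 + s ^+ 2) + (1 + s ^+ 2) * (y * y')
    & forall B : R, exists M : R, forall s w, (forall r, `|g r s w| <= B) ->
        `|s| <= M /\ `|w| <= M].
Proof.
have [a0 [a1 [Ca a01 a0_near a1_near]]] := @exists_profile R.
have [c0 [c0_ge1 c0a0 t0]] := exists_frequency (fun k => (Ca k).1) a0_near.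
have [c1 [c1_ge1 c1a1 t1]] : exists c, [/\ forall s, 1 <= c s,
    forall s, 4 * (1 + s ^+ 2) * derive1 a1 s ^+ 2 <= c s ^+ 2 & tame a1 c].
  apply: (@exists_frequency _ 0); first by move=> k; have [] := Ca k.
  by move=> n; rewrite subr0; exact: a1_near.
have oT : open [set: R] := openT.
have s_gt0 s : 0 < 1 + s ^+ 2 by rewrite ltr_pwDl ?sqr_ge0.
(* The part of the [ds^2] coefficient that the circular coordinates leave to [X], which must
   therefore have derivative [sqrt D]. *)
pose D s := (1 + s ^+ 2)^-1 - (derive1 a0 s / c0 s) ^+ 2 - (derive1 a1 s / c1 s) ^+ 2.
have D_ge s : (2 * (1 + s ^+ 2))^-1 <= D s.
  have key a c : 1 <= c -> 4 * (1 + s ^+ 2) * a ^+ 2 <= c ^+ 2 ->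
      (a / c) ^+ 2 <= (1 + s ^+ 2)^-1 / 4.
    move=> c_ge1 ac; have c_gt0 : 0 < c by rewrite (lt_le_trans ltr01).
    rewrite expr_div_n ler_pdivrMr ?exprn_gt0// -mulrA ler_pdivlMl//.
    by move: ac; set u := (1 + s ^+ 2); set v := a ^+ 2; set z := c ^+ 2; lra.
  have := key _ _ (c0_ge1 s) (c0a0 s); have := key _ _ (c1_ge1 s) (c1a1 s).
  by rewrite /D invfM; lra.
have D_gt0 s : 0 < D s by rewrite (lt_le_trans _ (D_ge s))// invr_gt0 mulr_gt0.
have CD k : class_C k [set: R] D.
  have cid := class_C_id k [set: R].
  have CB a c : tame a c -> class_C k [set: R] (fun s => - (derive1 a s / c s) ^+ 2).
    move=> tac; apply: class_CN => //.
    by apply: class_CM => //; exact: class_C_tame.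
  apply: class_CD => //; last exact: CB.
  apply: class_CD => //; last exact: CB.
  apply: (@class_C_comp _ _ _ _ [set x | 0 < x] (fun x => x^-1)) (class_C_inv k) _ => //.
    by move=> s _; exact: s_gt0.
  by apply: class_CD => //; [exact: class_C_cst|exact: class_CM].
have CsD k : class_C k [set: R] (fun s => Num.sqrt (D s)).
  by apply: (@class_C_comp _ _ _ _ [set x | 0 < x]) (class_C_sqrt k) _ => // s _; exact: D_gt0.
have [|X dX] := @exists_antiderivative R (fun s => Num.sqrt (D s)).
  by move=> s; exact: (CsD 0%N).
have CX k : class_C k [set: R] X by apply: class_CW; exact: class_C1 (CsD k).
exists (fun r s w => nth 0 [:: X s; w;
  a0 s / c0 s * cos (c0 s * w); a0 s / c0 s * sin (c0 s * w);
  a1 s / c1 s * cos (c1 s * w); a1 s / c1 s * sin (c1 s * w)] r).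
exists (fun r s w x y => nth 0 [:: x * Num.sqrt (D s); y;
  derive1 a0 s / c0 s * cos (c0 s * w) * x + a0 s * - sin (c0 s * w) * y;
  derive1 a0 s / c0 s * sin (c0 s * w) * x + a0 s * cos (c0 s * w) * y;
  derive1 a1 s / c1 s * cos (c1 s * w) * x + a1 s * - sin (c1 s * w) * y;
  derive1 a1 s / c1 s * sin (c1 s * w) * x + a1 s * cos (c1 s * w) * y] r).
have c0_neq0 s : c0 s != 0 by rewrite gt_eqF// (lt_le_trans ltr01).
have c1_neq0 s : c1 s != 0 by rewrite gt_eqF// (lt_le_trans ltr01).
split.
- move=> V U S W k r oU CS CW; have [csin ccos] := @class_C_sin_cos R k setT.
  case: r => [[|[|[|[|[|[|//]]]]]] ?] /=; rewrite //;
    try by apply: class_C_tame_comp.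
  by apply: (@class_C_comp _ _ _ _ setT) (CX k) CS.
- move=> V z S W dS dW r dSz dWz.
  case: r => [[|[|[|[|[|[|//]]]]]] ?] /=; rewrite //;
    try by apply: is_diff_tame_comp.
  exact: is_diff_comp1 dSz (dX _).
- move=> s w x y x' y'; rewrite !big_ord_recl big_ord0 /=.
  (* Each pair of circular coordinates contributes a diagonal form, the cross terms cancelling. The
     second coordinate adds 1 to [a0 ^+ 2 + a1 ^+ 2 = s ^+ 2], which gives the coefficient
     [1 + s ^+ 2] of [dw^2]. *)
  have key A a u : (A * cos u * x + a * - sin u * y) * (A * cos u * x' + a * - sin u * y')
      + (A * sin u * x + a * cos u * y) * (A * sin u * x' + a * cos u * y')
      = A ^+ 2 * (x * x') + a ^+ 2 * (y * y').
    by rewrite -[RHS]mul1r -(cos2Dsin2 u); ring.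
  have E0 := key (derive1 a0 s / c0 s) (a0 s) (c0 s * w).
  have E1 := key (derive1 a1 s / c1 s) (a1 s) (c1 s * w).
  rewrite addr0 [X in _ + (_ + X)]addrA E0 E1.
  have -> : x * Num.sqrt (D s) * (x' * Num.sqrt (D s)) = x * x' * D s.
    by rewrite mulrACA -expr2 sqr_sqrtr// ltW.
  by rewrite /D -(a01 s); ring.
(* The second coordinate is [w], so [B] bounds it; the exponential bounds [s] through the
   logarithmic growth of [X]. *)
- move=> B; exists (B + expR (2 * (B + `|X 0|))) => s w gB.
  have B0 : 0 <= B by apply: le_trans (gB ord0).
  have w_le : `|w| <= B by exact: (gB (lift ord0 ord0)).
  split; last by rewrite (le_trans w_le)// lerDl expR_ge0.
  have {gB}X_le : `|X s| <= B by exact: (gB ord0).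
  rewrite (@le_trans _ _ (expR (2 * (B + `|X 0|))))//; last by rewrite lerDr.
  have D_sqrt t : (2 * (1 + `|t|))^-1 <= Num.sqrt (D t).
    have tpos : 0 < 2 * (1 + `|t|) by rewrite mulr_gt0// ltr_pwDl.
    rewrite -(ler_pXn2r (n := 2)) ?nnegrE ?sqrtr_ge0 ?invr_ge0 ?(ltW tpos)//.
    rewrite sqr_sqrtr ?(ltW (D_gt0 _))//.
    apply: le_trans (D_ge t); rewrite exprVn lef_pV2 ?posrE ?exprn_gt0 ?mulr_gt0//.
    by rewrite -real_normK ?num_real//; have := normr_ge0 t; nra.
  have [s0|s0] := leP 0 s.
    rewrite ger0_norm//; apply: le_trans (ln_growth dX _ s0) _.
      by move=> t t_ge0; rewrite -{1}(ger0_norm t_ge0).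
    have := ler_norm (X s); have := ler_norm (- X 0); rewrite normrN ler_expR; lra.
  rewrite ltr0_norm//.
  (* Negative [s] reduces to the positive case through the reflected primitive [- X (- t)]. *)
  have dX' t : is_derive t 1 (fun t => - X (- t)) (Num.sqrt (D (- t))).
    have dN : is_derive t 1 (fun t : R => - t) (-1) by exact: is_deriveNid.
    have := is_deriveN (is_derive1_comp (dX (- t)) dN).
    by rewrite mulrN1 opprK.
  have s0' : 0 <= - s by rewrite oppr_ge0 ltW.
  apply: le_trans (ln_growth dX' _ s0') _.
    by move=> t t_ge0; rewrite -{1}(ger0_norm t_ge0) -normrN.
  have := ler_norm (- X s); have := ler_norm (X 0); rewrite normrN ler_expR oppr0 opprK; lra.
Qed.

End Plane.

(** * Coordinate functions *)

Section Space.
Context {R : realType}.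

Lemma continuous_linear_coord n (j : 'I_n) :
  exists2 f : {linear ('rV[R]_n * R)%type -> R}, continuous f &
    (f : _ -> _) = (fun p => p.1 0 j).
Proof.
have f_lin : linear (fun p : 'rV[R]_n * R => p.1 0 j : R) by move=> a u v; rewrite !mxE.
pose fM := GRing.isLinear.Build _ _ _ _ _ f_lin.
pose f : {linear ('rV[R]_n * R)%type -> R} := HB.pack (fun p : 'rV[R]_n * R => p.1 0 j : R) fM.
exists f => // p; apply: (cvg_comp fst (fun v : 'rV[R]_n => v 0 j)); first exact: cvg_fst.
exact: coord_continuous.
Qed.

Lemma class_C_coord n k (U : set ('rV[R]_n * R)) (j : 'I_n) :
  class_C k U (fun p : 'rV[R]_n * R => p.1 0 j).
Proof. by have [f cf <-] := continuous_linear_coord j; exact: class_C_linear. Qed.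

Lemma is_diff_coord n (p : 'rV[R]_n * R) (j : 'I_n) :
  is_diff p (fun q : 'rV[R]_n * R => q.1 0 j) (fun v => v.1 0 j).
Proof.
have [f cf <-] := continuous_linear_coord j.
by split; [exact: linear_differentiable|exact: diff_lin].
Qed.

Lemma class_C_snd n k (U : set ('rV[R]_n * R)) :
  class_C k U (fun p : 'rV[R]_n * R => p.2).
Proof. by apply: (@class_C_linear _ _ _ _ _ snd) => p; exact: cvg_snd. Qed.

Lemma is_diff_snd n (p : 'rV[R]_n * R) :
  is_diff p (fun q : 'rV[R]_n * R => q.2) (fun v => v.2).
Proof.
have cf : continuous (snd : 'rV[R]_n * R -> R) by move=> q; exact: cvg_snd.
split; first exact: (linear_differentiable p cf).
exact: (diff_lin p cf).
Qed.

Lemma is_diff_entry n (p : 'rV[R]_n) (i : 'I_n) :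
  is_diff p (fun v : 'rV[R]_n => v 0 i : R) (fun v => v 0 i).
Proof.
have f_lin : linear (fun v : 'rV[R]_n => v 0 i : R) by move=> a u v; rewrite !mxE.
pose fM := GRing.isLinear.Build _ _ _ _ _ f_lin.
pose f : {linear 'rV[R]_n -> R} := HB.pack (fun v : 'rV[R]_n => v 0 i : R) fM.
have cf : continuous f by move=> q; exact: coord_continuous.
split; first exact: (linear_differentiable p cf).
exact: (diff_lin p cf).
Qed.

Lemma is_diff_row (V : normedModType R) n (F : V -> 'rV[R]_n) (p : V) (i : 'I_n)
    (f' : V -> R) : differentiable F p ->
  is_diff p (fun q => F q 0 i) f' -> forall v, 'd F p v 0 i = f' v.
Proof.
move=> dF [_ <-] v.
by have [_ ->] := is_diff_comp (differentiableP dF) (is_diff_entry (F p) i).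
Qed.

Lemma normr_coord_le n (v : 'rV[R]_n) i : `|v 0 i| <= `|v|.
Proof.
rewrite -[leRHS]/(mx_norm v) mx_normrE.
exact: (le_bigmax _ (fun ij : 'I_1 * 'I_n => `|v ij.1 ij.2|) (0, i)).
Qed.

Lemma dotv_mxvec K n (A B : 'M[R]_(K, n)) :
  dotv (mxvec A) (mxvec B) = \sum_(i < K) \sum_(j < n) A i j * B i j.
Proof.
rewrite /dotv pair_bigA (reindex _ (curry_mxvec_bij K n)) /=.
by apply: eq_bigr => -[i j] _; rewrite /= !mxvecE.
Qed.

End Space.

(** * Immersion of hyperbolic space *)

Section Immersion.
Context {R : realType} (n : nat).
Local Notation H := ('rV[R]_n.+1 * R)%type.
Implicit Types (p q u v : H) (j : 'I_n.+1).

(** The dimension is [m = n.+2], so [l ^+ 2 = m - 1] and [(dx_j^2 + dy^2 / (m - 1)) / y^2] is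
    [l ^- 2] times the half-plane metric in the coordinates [(l * x_j, y)]. This is why each plane
    map below is scaled by [l^-1]. *)
Let l : R := Num.sqrt n.+1%:R.
Let l_gt0 : 0 < l. Proof. by rewrite sqrtr_gt0 ltr0n. Qed.
Let l2 : l ^+ 2 = n.+1%:R. Proof. by rewrite sqr_sqrtr. Qed.

Let U : set H := [set p | 0 < p.2].

Let open_U : open U.
Proof.
apply: (@open_comp _ _ snd [set x : R | 0 < x]); last exact: open_gt.
by move=> p _; exact: cvg_snd.
Qed.

(* In the half-plane (l * x_j, y), sinh_j is the hyperbolic sine of the distance
   to the geodesic x = 0 and along_j the abscissa of the projection onto it. *)
Let sinh_ j p := l * p.1 0 j / p.2.
Let along_ j p := 2^-1 * ln ((l * p.1 0 j) ^+ 2 + p.2 ^+ 2).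

Let rad_gt0 j p : U p -> 0 < (l * p.1 0 j) ^+ 2 + p.2 ^+ 2.
Proof. by move=> Up; rewrite ltr_wpDl ?sqr_ge0// exprn_gt0. Qed.

Let class_C_sinh j k : class_C k U (sinh_ j).
Proof.
apply: class_CM => //.
  by apply: class_CM => //; [exact: class_C_cst|exact: class_C_coord].
apply: (@class_C_comp _ _ _ _ [set x | 0 < x] (fun x => x^-1)) (class_C_inv k) _ => //.
exact: class_C_snd.
Qed.

Let class_C_along j k : class_C k U (along_ j).
Proof.
apply: class_CM => //; first exact: class_C_cst.
apply: (@class_C_comp _ _ _ _ [set x | 0 < x]) (class_C_ln k) _ => //.
  by move=> p; exact: rad_gt0.
have h : class_C k U (fun p => l * p.1 0 j).
  by apply: class_CM => //; [exact: class_C_cst|exact: class_C_coord].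
have h2 : class_C k U (fun p => p.2) by exact: class_C_snd.
by apply: class_CD => //; apply: class_CM.
Qed.

Let dsinh j p v := l * (v.1 0 j * p.2 - p.1 0 j * v.2) / p.2 ^+ 2.
Let dalong j p v := (l ^+ 2 * (p.1 0 j * v.1 0 j) + p.2 * v.2) /
  ((l * p.1 0 j) ^+ 2 + p.2 ^+ 2).

Let is_diff_sinh j p : U p -> is_diff p (sinh_ j) (dsinh j p).
Proof.
move=> Up; have p0 : p.2 != 0 by rewrite gt_eqF.
have d1 := is_diffZ l (is_diff_coord p j).
have d2 := is_diff_comp1 (is_diff_snd p) (is_derive_inv p0).
apply: (@is_diff_eq _ _ _ _ _ _ _ (is_diffM d1 d2)).
apply/funext => v; rewrite /dsinh !fctE /GRing.scale/=.
by field.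
Qed.

Let is_diff_along j p : U p -> is_diff p (along_ j) (dalong j p).
Proof.
move=> Up; have p0 := rad_gt0 j Up.
have d1 := is_diffZ l (is_diff_coord p j).
have d2 := is_diff_snd p.
have d3 := is_diffD (is_diffM d1 d1) (is_diffM d2 d2).
have d4 := is_diffZ 2^-1 (is_diff_comp1 d3 (is_derive1_ln p0)).
apply: (@is_diff_eq _ _ _ _ _ _ _ d4).
apply/funext => v; rewrite /dalong !fctE /GRing.scale/=.
by field; exact: lt0r_neq0.
Qed.

Lemma exists_proper_isometric_immersion :
  exists F : hyperbolic R n.+2 -> euclidean R (n.+1 * 6),
    isometric_immersion F /\ proper_map F.
Proof.
have [g [dg [Cg Dg metg propg]]] := @exists_plane_immersion R.
pose G p : 'M[R]_(n.+1, 6) := \matrix_(j, r) (l^-1 * g r (sinh_ j p) (along_ j p)).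
pose F : hyperbolic R n.+2 -> euclidean R (n.+1 * 6) := fun p => mxvec (G p).
exists F.
pose dF p v := mxvec (\matrix_(j < n.+1, r < 6)
  (l^-1 * dg r (sinh_ j p) (along_ j p) (dsinh j p v) (dalong j p v))).
have FE p j r : F p 0 (mxvec_index j r) = l^-1 * g r (sinh_ j p) (along_ j p).
  by rewrite /F mxvecE mxE.
have CF k : class_C k U F.
  apply: class_C_row => // i; case/mxvec_indexP: i => j r.
  under eq_fun do rewrite FE.
  apply: class_CM => //; first exact: class_C_cst.
  exact: Cg.
have dFE p v : U p -> 'd F p v = dF p v.
  move=> Up; apply/rowP => i; case/mxvec_indexP: i => j r.
  rewrite mxvecE mxE.
  have d := is_diffZ l^-1 (Dg _ _ _ _ _ _ r (is_diff_sinh j Up) (is_diff_along j Up)).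
  have FjE : (l^-1 *: (fun q => g r (sinh_ j q) (along_ j q))) =
      (fun q => F q 0 (mxvec_index j r)).
    by apply/funext => q; rewrite FE.
  rewrite FjE in d.
  exact: (is_diff_row ((CF 1%N).1 p Up) d v).
have iso p u v : U p -> metric (euclidean R _) (F p) ('d F p u) ('d F p v) =
    metric (hyperbolic R n.+2) p u v.
  move=> Up; rewrite !dFE// /metric/= dotv_mxvec.
  have p0 : p.2 != 0 by rewrite gt_eqF.
  (* Block [j] yields [(dx_j^2 + dy^2 / n.+1) / y^2]; summing over the [n.+1] blocks restores the
     full [dy^2 / y^2]. *)
  transitivity (\sum_(j < n.+1) ((u.1 0 j * v.1 0 j) / p.2 ^+ 2 + 
     n.+1%:R^-1 * (u.2 * v.2 / p.2 ^+ 2))).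
    apply: eq_bigr => j _; under eq_bigr do rewrite !mxE mulrACA.
    rewrite -mulr_sumr metg -l2 /sinh_ /dsinh /dalong.
    have l0 := lt0r_neq0 l_gt0; have r0 := lt0r_neq0 (rad_gt0 j Up).
    by field; apply/and3P.
  rewrite big_split/= sumr_const card_ord -mulr_suml -[X in _ + X]mulr_natl.
  by rewrite [X in _ + X]mulrA mulfV ?pnatr_eq0// mul1r -mulrDl.
split.
  split => // [p Up a b dab|p Up u v]; last exact: iso.
  (* Injectivity follows from the isometry identity: a vector killed by the differential has
     hyperbolic norm 0. *)
  apply/eqP; rewrite -subr_eq0; apply/eqP.
  have : 'd F p (a - b) = 0 by rewrite linearB dab subrr.
  move: (a - b : H) => d d0; have := iso p d d Up.
  rewrite d0 /metric/= {1}/dotv big1 => [|i _]; last by rewrite mxE mul0r.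
  have p0 : (p.2 == 0) = false by rewrite gt_eqF.
  move/esym/eqP; rewrite mulf_eq0 invr_eq0 expf_eq0/= p0 orbF.
  have d_ge0 : 0 <= dotv d.1 d.1 by apply: sumr_ge0 => i _; rewrite -expr2 sqr_ge0.
  rewrite -expr2 paddr_eq0 ?sqr_ge0// sqrf_eq0 => /andP[/eqP d1 /eqP d2].
  suff d10 : d.1 = 0 by rewrite [d]surjective_pairing d10 d2.
  apply/rowP => i; rewrite [RHS]mxE; apply/eqP; rewrite -sqrf_eq0 expr2; apply/eqP.
  by apply: (psumr_eq0P _ d1) => // k _; rewrite -expr2 sqr_ge0.
have cF p : U p -> {for p, continuous F} by move=> Up; exact: (CF 0%N).
split => // K _ cK.
have [B KB] : exists B : R, forall z : euclidean R _, K z ->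
    forall i, `|(z : 'rV_(n.+1 * 6)) 0 i| <= B.
  have [B [_ HB]] := compact_bounded cK.
  exists (B + 1) => z Kz i; apply: le_trans (normr_coord_le z i) _.
  by apply: HB => //; rewrite ltrDl.
have [M HM] := propg (l * B).
have [M' M'_gt0 HM'] : exists2 M' : R, 0 < M' & forall p, U p -> K (F p) ->
    forall j, `|sinh_ j p| <= M' /\ `|along_ j p| <= M'.
  exists (Num.max M 1); first by rewrite lt_max ltr01 orbT.
  move=> p Up KFp j.
  have [|h1 h2] := HM (sinh_ j p) (along_ j p); last first.
    by rewrite !le_max h1 h2.
  move=> r; have := KB _ KFp (mxvec_index j r).
  by rewrite FE normrM gtr0_norm ?invr_gt0// ler_pdivrMl.
(* With [X = l * x_j], [w] the value of [along_] and [S] that of [sinh_], one has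
   [X^2 + y^2 = exp (2 w)], so [y] and [|X|] are at most [exp M']. Since [X = S y], also [y^2 (1 +
   S^2) = exp (2 w) >= exp (- 2 M')], whence [y >= e]. This positive lower bound keeps the compact
   box inside the open half-space. *)
pose e := expR (- M') / (1 + M'); pose T := expR M'.
have e_gt0 : 0 < e by rewrite divr_gt0 ?expR_gt0// addr_gt0.
pose Bx : set H := [set v : 'rV[R]_n.+1 | forall j, `[- T, T]%classic (v ord0 j)] `*` `[e, T]%classic.
have cBx : compact Bx.
  apply: compact_setX; last exact: segment_compact.
  by apply: (@rV_compact R _ (fun=> `[- T, T]%classic)) => j; exact: segment_compact.
have BxU : Bx `<=` U.
  by move=> p [_]; rewrite /= in_itv/= => /andP[+ _]; exact: lt_le_trans.
have subBx : U `&` F @^-1` K `<=` Bx.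
  move=> p [Up KFp]; have /= HMj := HM' p Up KFp.
  have key j : [/\ `|p.1 0 j| <= T, p.2 <= T & e <= p.2].
    have [hS hW] := HMj j.
    set X := l * p.1 0 j.
    have r0 : 0 < X ^+ 2 + p.2 ^+ 2 by exact: rad_gt0.
    have radE : X ^+ 2 + p.2 ^+ 2 = expR (along_ j p) ^+ 2.
      have half (a : R) : 2^-1 * a + 2^-1 * a = a by field.
      by rewrite [RHS]expr2 -expRD /along_ half lnK.
    have le_T : expR (along_ j p) ^+ 2 <= T ^+ 2.
      by rewrite ler_pXn2r ?nnegrE ?expR_ge0// ler_expR (le_trans (ler_norm _)).
    have ge_T : expR (- M') ^+ 2 <= expR (along_ j p) ^+ 2.
      rewrite ler_pXn2r ?nnegrE ?expR_ge0// ler_expR lerNl.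
      by rewrite (le_trans (ler_norm _))// normrN.
    have T_ge0 : 0 <= T by exact: expR_ge0.
    have XE : X = sinh_ j p * p.2 by rewrite /sinh_ divfK// gt_eqF.
    split.
    - have l_ge1 : 1 <= l by rewrite -[leLHS]sqrtr1 ler_sqrt// ler1n.
      have : `|X| <= T.
        rewrite -(ler_pXn2r (n := 2)) ?nnegrE// real_normK ?num_real//.
        by apply: le_trans le_T; rewrite -radE lerDl sqr_ge0.
      apply: le_trans; rewrite normrM gtr0_norm// ler_peMl//.
    - rewrite -(ler_pXn2r (n := 2)) ?nnegrE ?(ltW Up)//.
      by apply: le_trans le_T; rewrite -radE lerDr sqr_ge0.
    - rewrite ler_pdivrMr ?addr_gt0//.
      move: hS XE; move: (sinh_ j p) => S hS XE.
      rewrite -(ler_pXn2r (n := 2)) ?nnegrE ?expR_ge0 ?mulr_ge0 ?addr_ge0 ?(ltW Up) ?(ltW M'_gt0)//.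
      apply: le_trans ge_T _; rewrite -radE XE !exprMn -[X in _ + X <= _]mul1r -mulrDl mulrC.
      rewrite ler_wpM2l ?sqr_ge0// -real_normK ?num_real//.
      by have := normr_ge0 S; nra.
  split; first by move=> j; rewrite /= in_itv/= -ler_norml; have [] := key j.
  by rewrite /= in_itv/=; have [_ -> ->] := key ord0.
apply: (subclosed_compact _ cBx subBx).
(* A limit point of the preimage stays in the box, hence in the domain, where [F] is continuous;
   closedness of [K] then applies. *)
move=> p clp; have Bxp : Bx p.
  apply: (compact_closed _ cBx); first exact: norm_hausdorff.
  exact: closure_subset subBx _ clp.
split; first exact: BxU.
have clK : closed K by apply: compact_closed cK; exact: norm_hausdorff.
apply: clK => N NFp.
have /clp := cF p (BxU _ Bxp) N NFp.
by move=> [q [[Uq KFq] NFq]]; exists (F q).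
Qed.

End Immersion.

(** * Riemannian distances *)

Section Distances.
Context {R : realType}.
Local Notation mu := (@lebesgue_measure R).

Lemma riemannian_dist_ge0 (M : riemannian_chart R) (x y : M) :
  (0 <= riemannian_dist x y)%E.
Proof.
apply: le_ereal_inf_tmp => _ [gamma _ <-].
by apply: integral_ge0 => t _; rewrite lee_fin sqrtr_ge0.
Qed.

Lemma is_derive_line (V : normedModType R) (p v : V) (t : R) :
  is_derive t 1 (fun s : R => p + s *: v) v.
Proof.
have d : is_derive t 1 (fun s : R => s *: v) v.
  have [dv vE] : is_diff t (fun s : R => s *: v) (fun s : R => s *: v).
    exact: is_diff_scalel.
  apply: DeriveDef; first exact/derivable1_diffP.
  by rewrite deriveE// vE scale1r.
by have := is_deriveD (is_derive_cst p t 1) d; rewrite add0r.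
Qed.

Lemma euclidean_dist_le n (p q : 'rV[R]_n) :
  (riemannian_dist (p : euclidean R n) q <= (Num.sqrt (dotv (q - p) (q - p)))%:E)%E.
Proof.
pose gamma : R -> euclidean R n := fun t => p + t *: (q - p).
have dg (t : R) : is_derive t 1 gamma (q - p) by exact: is_derive_line.
have gE : derive1 gamma = fun=> q - p.
  by apply/funext => t; rewrite derive1E derive_val.
apply: (@le_trans _ _ (curve_length gamma)).
  apply: ereal_inf_lbound; exists gamma => //; split => //.
  - by rewrite gE => t; exact: cvg_cst.
  - by rewrite /gamma scale0r addr0.
  - by rewrite /gamma scale1r addrC subrK.
rewrite /curve_length gE /metric/= integral_cst//=.
by rewrite lebesgue_measure_itv/= lte_fin ltr01 sube0 mule1.
Qed.

Lemma is_derive_diff_comp (V : normedModType R) (gamma : R -> V) (f df : V -> R) t :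
  derivable gamma t 1 -> is_diff (gamma t) f df ->
  is_derive t 1 (fun s => f (gamma s)) (df (derive1 gamma t)).
Proof.
move=> /derivable1_diffP dg df'.
have := is_diff_comp (differentiableP dg) df'.
move=> [hd hv]; apply: DeriveDef; first exact/derivable1_diffP.
by rewrite deriveE// hv /= diff1E//= scale1r.
Qed.

Lemma sqr_fst_le_dotv n (v : 'rV[R]_n.+1) : v 0 0 ^+ 2 <= dotv v v.
Proof.
by rewrite /dotv big_ord_recl -expr2 lerDl sumr_ge0// => i _; rewrite -expr2 sqr_ge0.
Qed.

(* The Busemann function at the boundary point (a, 0), which is 1-Lipschitz. *)
Definition busemann n (a : R) (p : 'rV[R]_n.+1 * R) : R :=
  ln ((p.1 0 0 - a) ^+ 2 + p.2 ^+ 2) - ln p.2.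

Definition dbusemann n (a : R) (p v : 'rV[R]_n.+1 * R) : R :=
  2 * ((p.1 0 0 - a) * v.1 0 0 + p.2 * v.2) / ((p.1 0 0 - a) ^+ 2 + p.2 ^+ 2)
  - v.2 / p.2.

Lemma is_diff_busemann n a (p : 'rV[R]_n.+1 * R) : 0 < p.2 ->
  is_diff p (busemann a) (dbusemann a p).
Proof.
move=> p0; have r0 : 0 < (p.1 0 0 - a) ^+ 2 + p.2 ^+ 2.
  by rewrite ltr_wpDl ?sqr_ge0// exprn_gt0.
have d1 : is_diff p (fun q : 'rV[R]_n.+1 * R => q.1 0 0 - a) (fun v => v.1 0 0).
  have := is_diffB (is_diff_coord p 0) (is_diff_cst a p).
  by rewrite subr0.
have d2 := is_diff_snd p.
have d3 := is_diffD (is_diffM d1 d1) (is_diffM d2 d2).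
have d4 := is_diff_comp1 d3 (is_derive1_ln r0).
have d5 := is_diffB d4 (is_diff_comp1 d2 (is_derive1_ln p0)).
apply: (@is_diff_eq _ _ _ _ _ _ _ d5).
apply/funext => v; rewrite /dbusemann !fctE /GRing.scale/=.
by field; rewrite !lt0r_neq0.
Qed.

Lemma dbusemann_le n a (p v : 'rV[R]_n.+1 * R) : 0 < p.2 ->
  dbusemann a p v <= Num.sqrt ((dotv v.1 v.1 + v.2 * v.2) / p.2 ^+ 2).
Proof.
move=> p0; apply: le_trans (ler_norm _) _; rewrite -sqrtr_sqr ler_sqrt; last first.
  by rewrite divr_ge0 ?sqr_ge0// addr_ge0 -?expr2 ?sqr_ge0// sumr_ge0// => i _;
    rewrite -expr2 sqr_ge0.
rewrite /dbusemann; have := sqr_fst_le_dotv v.1.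
move: (p.1 0 0 - a) (p.2) p0 (v.1 0 0) (v.2) (dotv v.1 v.1) => x y y0 b c d bd.
have r0 : 0 < x ^+ 2 + y ^+ 2 by rewrite ltr_wpDl ?sqr_ge0// exprn_gt0.
apply: (@le_trans _ _ ((b ^+ 2 + c * c) / y ^+ 2)); last first.
  by rewrite ler_pM2r ?invr_gt0 ?exprn_gt0// lerD2r.
rewrite -subr_ge0.
(* In the plane of the first horizontal coordinate and the height, the gradient of the Busemann
   function is a hyperbolic unit vector. The difference is the square of the component of the vector
   orthogonal to it. *)
have -> : (b ^+ 2 + c * c) / y ^+ 2 - (2 * (x * b + y * c) / (x ^+ 2 + y ^+ 2) - c / y) ^+ 2
  = (((y ^+ 2 - x ^+ 2) * b - 2 * x * y * c) / (y * (x ^+ 2 + y ^+ 2))) ^+ 2.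
  by field; rewrite !lt0r_neq0.
exact: sqr_ge0.
Qed.

Definition slice_point n (x y : R) : hyperbolic R n.+2 :=
  (x *: delta_mx 0 0, y).

(** The Busemann function at [(a, 0)] is 0 at the first point and [ln ((b - a) ^+ 2 + 1)] at the
    second. Its derivative along a curve is at most the speed, so its increment is at most the
    length. *)
Lemma horocycle_dist_ge n (a b : R) :
  ((ln ((b - a) ^+ 2 + 1)%R)%:E <=
   riemannian_dist (slice_point n a 1) (slice_point n b 1))%E.
Proof.
apply: le_ereal_inf_tmp => _ [gamma [dg cg gU g0 g1] <-].
pose h t := dbusemann a (gamma t) (derive1 gamma t).
have U01 (t : R) : t \in `[0%R, 1%R] -> 0 < (gamma t).2.
  by rewrite in_itv/= => /gU.
have dh (t : R) : t \in `[0%R, 1%R] -> is_derive t 1 (fun t => busemann a (gamma t)) (h t).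
  by move=> /U01 gt0; exact: is_derive_diff_comp (dg t) (is_diff_busemann a gt0).
have dcg (t : R) : {for t, continuous gamma}.
  by apply/differentiable_continuous/derivable1_diffP.
have cc1 (f : R -> 'rV[R]_n.+1 * R) (t : R) i : {for t, continuous f} ->
    {for t, continuous (fun t => (f t).1 0 i)}.
  move=> cf; apply: (cvg_comp (fun t => (f t).1) (fun v : 'rV[R]_n.+1 => v 0 i)).
    by apply: (cvg_comp f fst cf); exact: cvg_fst.
  exact: coord_continuous.
have cc2 (f : R -> 'rV[R]_n.+1 * R) (t : R) : {for t, continuous f} ->
    {for t, continuous (fun t => (f t).2)}.
  by move=> cf; apply: (cvg_comp f snd cf); exact: cvg_snd.
pose L t := Num.sqrt (metric (hyperbolic R n.+2) (gamma t) (derive1 gamma t) (derive1 gamma t)).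
have cdot : continuous (fun t => dotv (derive1 gamma t).1 (derive1 gamma t).1).
  have /= H := @class_C_sum _ _ _ 0%N [set: R] n.+1
    (fun i t => (derive1 gamma t).1 0 i * (derive1 gamma t).1 0 i) openT.
  by move=> t; apply: H => // i s _; apply: cvgM; exact: cc1 (cg s).
have cL : {within `[0%R, 1%R], continuous L}.
  apply: continuous_in_subspaceT => t; rewrite inE/= => /U01 g_gt0.
  apply: (@cvg_comp _ _ _ _ Num.sqrt _ _ _ _ (@sqrt_continuous R _)).
  apply: cvgM; last first.
    apply: cvgV; first by rewrite expf_eq0/= gt_eqF.
    by apply: cvgM; exact: cc2 (dcg t).
  apply: cvgD; first exact: cdot.
  by apply: cvgM; exact: cc2 (cg t).
have ch : {within `[0%R, 1%R], continuous h}.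
  apply: continuous_in_subspaceT => t; rewrite inE/= => /U01 g_gt0.
  have c1 : (gamma s).1 0 0 - a @[s --> t] --> (gamma t).1 0 0 - a.
    by apply: cvgB; [exact: cc1 (dcg t)|exact: cvg_cst].
  have c2 := cc2 _ _ (dcg t).
  have d1 := cc1 _ _ 0 (cg t); have d2 := cc2 _ _ (cg t).
  apply: cvgB; last by apply: cvgM => //; apply: cvgV => //; rewrite gt_eqF.
  apply: cvgM; last first.
    apply: cvgV; last by apply: cvgD; apply: cvgM.
    by rewrite gt_eqF// ltr_wpDl ?sqr_ge0// exprn_gt0.
  by apply: cvgM; [exact: cvg_cst|apply: cvgD; apply: cvgM].
have hL : (\int[mu]_(t in `[0%R, 1%R]) (h t)%:E <= \int[mu]_(t in `[0%R, 1%R]) (L t)%:E)%E.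
  apply: le_integral.
  - exact: measurable_itv.
  - by apply: continuous_compact_integrable => //; exact: segment_compact.
  - by apply: continuous_compact_integrable => //; exact: segment_compact.
  - move=> t; rewrite inE/= => /U01 g_gt0; rewrite lee_fin.
    exact: dbusemann_le.
apply: le_trans hL.
have cb (t : R) : t \in `[0%R, 1%R] -> {for t, continuous (fun t => busemann a (gamma t))}.
  by move=> /dh[d _]; apply/differentiable_continuous/derivable1_diffP.
rewrite (@continuous_FTC2 _ h (fun t => busemann a (gamma t)))//.
- rewrite g0 g1 /busemann/= !mxE eqxx !mulr1 subrr expr0n/= add0r expr1n ln1 !subr0.
  by rewrite sube0.
- split.
  + move=> t t01; have t01' : t \in `[0%R, 1%R] by apply: subset_itv_oo_cc.
    by have [] := dh t t01'.
  + by apply: cvg_at_right_filter; apply: cb; rewrite in_itv/= lexx ler01.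
  + by apply: cvg_at_left_filter; apply: cb; rewrite in_itv/= lexx ler01.
- move=> t t01; have t01' : t \in `[0%R, 1%R] by apply: subset_itv_oo_cc.
  by rewrite derive1E; have [_ ->] := dh t t01'.
Qed.

End Distances.

(** * Failure of strong properness *)

Section NoStrongProperness.
Context {R : realType}.

(** * Displacement of the image coordinates along coordinate segments *)

Section Oscillation.
Variables (n d : nat) (F : hyperbolic R n.+2 -> euclidean R d).
Hypothesis isoF : isometric_immersion F.
Implicit Types p v : 'rV[R]_n.+1 * R.

(** The hypothesis bounds by [C] the hyperbolic speed along the segment from [p] to [p + v]. The
    mean value theorem in coordinate [i] bounds the increment by the norm of ['d F v] at some point,
    which equals that speed. *)
Lemma segment_osc_le p v (C : R) i : 0 <= C ->
  (forall t, 0 <= t <= 1 -> 0 < (p + t *: v).2 /\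
     dotv v.1 v.1 + v.2 * v.2 <= C ^+ 2 * (p + t *: v).2 ^+ 2) ->
  `|(F (p + v) : 'rV[R]_d) 0 i - (F p : 'rV[R]_d) 0 i| <= C.
Proof.
move=> C0 hv; have [[_ /(_ 1%N)[dF _]] _ isoE] := isoF.
pose f (t : R) : R := (F (p + t *: v) : 'rV[R]_d) 0 i.
pose df (t : R) : R := ('d F (p + t *: v) v : 'rV[R]_d) 0 i.
have f'E (t : R) : 0 <= t <= 1 -> is_derive t 1 f (df t).
  move=> /hv[U _].
  have dFi : is_diff (p + t *: v) (fun q => (F q : 'rV[R]_d) 0 i)
      (fun w => ('d F (p + t *: v) w : 'rV[R]_d) 0 i).
    exact: is_diff_comp (differentiableP (dF _ U)) (is_diff_entry _ i).
  have [dg1 dg2] := is_derive_line p v t.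
  have := is_derive_diff_comp dg1 dFi.
  by rewrite derive1E dg2.
have [|| t t01 fE] := @MVT_segment _ f df 0 1 ler01.
- by move=> t t01; apply: f'E; have := subset_itv_oo_cc t01; rewrite in_itv.
- apply: continuous_in_subspaceT => t; rewrite inE/= => /f'E[dft _].
  exact/differentiable_continuous/derivable1_diffP.
have -> : (F (p + v) : 'rV[R]_d) 0 i = f 1 by rewrite /f scale1r.
have -> : (F p : 'rV[R]_d) 0 i = f 0 by rewrite /f scale0r addr0.
move: t01; rewrite in_itv/= => /hv[U le_C].
rewrite fE subr0 mulr1 -(ler_pXn2r (n := 2)) ?nnegrE// real_normK ?num_real//.
have := isoE _ U v v; rewrite /metric/= => E.
apply: (@le_trans _ _ (dotv ('d F (p + t *: v) v) ('d F (p + t *: v) v))).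
  rewrite /dotv (bigD1 i)//= -expr2 lerDl sumr_ge0// => k _.
  by rewrite -expr2 sqr_ge0.
by rewrite E ler_pdivrMr// exprn_gt0.
Qed.

Let f i x y : R := (F (slice_point n x y) : 'rV[R]_d) 0 i.

Lemma horizontal_osc_le i x x' y : 0 < y -> `|x' - x| <= y -> `|f i x' y - f i x y| <= 1.
Proof.
move=> y0 xx'.
have := @segment_osc_le (slice_point n x y) ((x' - x) *: delta_mx 0 0, 0) 1 i ler01.
have -> : slice_point n x y + ((x' - x) *: delta_mx 0 0, 0) = slice_point n x' y.
  by congr pair; rewrite /= ?addr0// -scalerDl addrC subrK.
apply=> t t01; rewrite /= scaler0 addr0; split => //.
rewrite mulr0 addr0 expr1n mul1r /dotv big_ord_recl big1 => [|k _]; last first.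
  by rewrite !mxE/= mulr0 mul0r.
rewrite !mxE eqxx mulr1 addr0 -expr2 -real_normK ?num_real//.
by rewrite ler_pXn2r ?nnegrE// ltW.
Qed.

Lemma vertical_osc_le i x y : 0 < y -> `|f i x (2 * y) - f i x y| <= 1.
Proof.
move=> y0.
have := @segment_osc_le (slice_point n x y) (0, y) 1 i ler01.
have -> : slice_point n x y + (0, y) = slice_point n x (2 * y).
  by congr pair; rewrite /= ?addr0// mulr_natl mulr2n.
apply=> t /andP[t0 t1]; rewrite /=; have ty : 0 <= t *: y by exact: mulr_ge0 (ltW y0).
split; first by rewrite ltr_wpDr.
rewrite expr1n mul1r /dotv big1 => [|k _]; last by rewrite !mxE mul0r.
by rewrite add0r -expr2 ler_pXn2r ?nnegrE ?addr_ge0 ?(ltW y0)// lerDl.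
Qed.

(** Over each end, [s] doublings of the height join it to level [2 ^+ s], where one horizontal move
    of hyperbolic length at most 1 connects the two; each step moves the coordinate by at most 1. *)
Lemma horocycle_osc_le i x s : 0 <= x <= 2 ^+ s ->
  `|f i x 1 - f i 0 1| <= 2 * s%:R + 1.
Proof.
move=> /andP[x0 xs].
have vert z : `|f i z (2 ^+ s) - f i z 1| <= s%:R.
  elim: s {xs} => [|s IH]; first by rewrite expr0 subrr normr0.
  rewrite exprS -natr1.
  have := @vertical_osc_le i z (2 ^+ s); rewrite exprn_gt0// => /(_ isT) h.
  by move: IH h; rewrite !ler_norml; lra.
have hor : `|f i x (2 ^+ s) - f i 0 (2 ^+ s)| <= 1.
  by apply: horizontal_osc_le; [exact: exprn_gt0|rewrite subr0 ger0_norm].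
have := vert x; have := vert 0; move: hor; rewrite !ler_norml; lra.
Qed.

End Oscillation.

(** * Pigeonhole on a horocycle *)

Lemma exp_dominates (a b d : nat) : exists s, ((a * s + b) ^ d < 2 ^ s)%N.
Proof.
have [c cE] : exists c, c = ((a + b) * (d.+1 * 2))%N by exists ((a + b) * (d.+1 * 2))%N.
have [v vE] : exists v, v = c.+1 by exists c.+1.
(* For this [s], [a * s + b <= c * v < 2 ^ (2 * v)] because [c < v < 2 ^ v]; the [d]-th power is
   then at most [2 ^ (2 * v * d)], which is below [2 ^ s]. *)
exists (d.+1 * (2 * v))%N.
have cv : (c * v < 2 ^ (2 * v))%N.
  rewrite mul2n -addnn expnD; apply: ltn_mul; last exact: ltn_expl.
  by apply: (@ltn_trans v); [rewrite vE|exact: ltn_expl].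
have le_cv : (a * (d.+1 * (2 * v)) + b <= c * v)%N.
  have -> : (c * v = a * (d.+1 * (2 * v)) + b * (d.+1 * (2 * v)))%N by rewrite cE; ring.
  by rewrite leq_add2l leq_pmulr// vE.
apply: (@leq_ltn_trans ((2 ^ (2 * v)) ^ d)%N).
  have [->|d0] := posnP d; first by rewrite !expn0.
  by rewrite leq_exp2r// (leq_trans le_cv (ltnW cv)).
by rewrite -expnM ltn_exp2l// [ltnLHS]mulnC ltn_pmul2r// vE.
Qed.

Lemma horocycle_close_points n d (F : hyperbolic R n.+2 -> euclidean R d) (D : R) (l : nat) :
  isometric_immersion F -> exists a b : R, D <= `|b - a| /\
    forall i, `|(F (slice_point n b 1) : 'rV[R]_d) 0 i
              - (F (slice_point n a 1) : 'rV[R]_d) 0 i| <= l.+1%:R^-1.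
Proof.
move=> isoF.
pose t := (Num.trunc D).+1.
(* The [2 ^ s] points have first coordinate at most [2 ^ (s + t)], so each image coordinate stays
   within [T = 2 (s + t) + 1] of its value at the point with index 0. Cutting this range of length
   [2 T] into pieces of length [1 / l.+1] takes [Q = 2 T l.+1 + 1] indices, both ends included, and
   [Q ^ d < 2 ^ s]. *)
have [s Hs] := exp_dominates (4 * l.+1) ((4 * t + 2) * l.+1 + 1) d.
set Q := (_ + _)%N in Hs.
pose f i (k : nat) : R := (F (slice_point n (2 ^+ t * k%:R) 1) : 'rV[R]_d) 0 i.
pose T : R := 2 * (s + t)%:R + 1.
have f_le i (k : 'I_(2 ^ s)) : `|f i k - f i 0%N| <= T.
  rewrite /f mulr0; apply: horocycle_osc_le => //.
  rewrite mulr_ge0 ?exprn_ge0//= addnC exprD ler_wpM2l ?exprn_ge0//.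
  by rewrite -natrX ler_nat ltnW.
pose g i (k : nat) : R := l.+1%:R * (f i k - f i 0%N + T).
have g_ge0 i (k : 'I_(2 ^ s)) : 0 <= g i k.
  by rewrite mulr_ge0//; have := f_le i k; rewrite ler_norml; lra.
have g_lt i (k : 'I_(2 ^ s)) : g i k < Q%:R.
  have -> : Q%:R = l.+1%:R * (2 * T) + 1 :> R.
    by rewrite /Q /T !(natrD, natrM); ring.
  rewrite ltr_pwDr// ler_wpM2l//.
  by have := f_le i k; rewrite ler_norml; lra.
have Qn (i : 'I_d) (k : 'I_(2 ^ s)) : (Num.trunc (g i k) < Q)%N.
  by rewrite -(ltr_nat R) (le_lt_trans _ (g_lt i k))// truncn_le.
pose cell (k : 'I_(2 ^ s)) : {ffun 'I_d -> 'I_Q} := [ffun i => Ordinal (Qn i k)].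
(* Two distinct points share a cell. Equal integer parts in every coordinate will put the rescaled
   values less than 1 apart. *)
have /injectivePn[k1 [k2 k12 cell12]] : ~~ injectiveb cell.
  apply: contraL Hs => /injectiveP/leq_card.
  by rewrite card_ffun !card_ord -leqNgt.
exists (2 ^+ t * k1%:R), (2 ^+ t * k2%:R); split.
  have Dt : D <= 2 ^+ t.
    by rewrite (le_trans (ltW (truncnS_gt D)))// -natrX ler_nat ltnW// ltn_expl.
  apply: le_trans Dt _.
  rewrite -mulrBr normrM ger0_norm ?exprn_ge0// ler_peMr ?exprn_ge0//.
  have nat_dist (j k : nat) : (j < k)%N -> 1 <= `|k%:R - j%:R| :> R.
    by move=> jk; apply: le_trans (ler_norm _); rewrite lerBrDr -(natrD _ 1) ler_nat.
  have [lt12|lt21|eq12] := ltngtP k1 k2; first exact: nat_dist.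
    by rewrite distrC; exact: nat_dist.
  by case/eqP: k12; exact: val_inj.
move=> i; have /ffunP/(_ i) := cell12.
rewrite !ffunE => /(congr1 val)/= E.
have := truncn_itv (g_ge0 i k1); have := truncn_itv (g_ge0 i k2); rewrite E.
have l0 : 0 < l.+1%:R :> R by rewrite ltr0n.
rewrite -natr1 /g => /andP[h1 h2] /andP[h3 h4].
rewrite -[leRHS]mulr1 ler_pdivlMl// -[X in X * _](gtr0_norm l0) -normrM ler_norml.
rewrite -/(f i k1) -/(f i k2).
by apply/andP; split; lra.
Qed.

Lemma not_strongly_proper n d (F : hyperbolic R n.+2 -> euclidean R d) :
  isometric_immersion F -> ~ strongly_proper F.
Proof.
move=> isoF spF.
(* A separation of at least [expR l] makes the hyperbolic distance at least [ln (expR l) = l], hence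
   divergent, while the images differ by at most [1 / l.+1] in each coordinate. *)
have /choice[a /choice[b ab]] := fun l => @horocycle_close_points n d F (expR l%:R) l isoF.
pose x l := slice_point n (a l) 1; pose y l := slice_point n (b l) 1.
have dist_y : riemannian_dist (x l) (y l) @[l --> \oo] --> +oo%E.
  apply: (@gee_cvgy _ _ _ _ (fun l => (l%:R : R)%:E)); last exact/cvgeryP/cvgr_idn.
  near=> l; apply: le_trans (horocycle_dist_ge n (a l) (b l)).
  have [ab_ge _] := ab l.
  rewrite lee_fin -[leLHS]expRK ler_ln ?posrE ?expR_gt0 ?ltr_wpDl ?sqr_ge0//.
  by apply: le_trans ab_ge _; rewrite -[X in X + 1]real_normK ?num_real//; nra.
have := spF x y (fun=> ltr01) (fun=> ltr01) dist_y.
suff /cvg_limn_einf_sup[-> _] :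
    riemannian_dist (F (x l)) (F (y l)) @[l --> \oo] --> 0%E by rewrite ltxx.
(* The Euclidean distance is at most [sqrt d / l.+1]; the cruder factor [d] avoids the root. *)
apply: (@squeeze_cvge _ _ _ _ (cst 0%E) _ (fun l => (d%:R * l.+1%:R^-1 : R)%:E)).
- near=> l; rewrite riemannian_dist_ge0/=.
  apply: le_trans (euclidean_dist_le _ _) _; rewrite lee_fin.
  have e_ge0 : 0 <= d%:R * l.+1%:R^-1 :> R by rewrite mulr_ge0// invr_ge0.
  rewrite -(ger0_norm e_ge0) -sqrtr_sqr ler_wsqrtr// exprMn.
  apply: (@le_trans _ _ (\sum_(i < d) l.+1%:R^-1 ^+ 2)); last first.
    rewrite sumr_const card_ord -[leLHS]mulr_natl ler_wpM2r ?sqr_ge0//.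
    by rewrite -natrX ler_nat; case: (d) => // k; rewrite leq_pmull.
  apply: ler_sum => i _; rewrite -expr2 -real_normK ?num_real//.
  by rewrite ler_pXn2r ?nnegrE ?invr_ge0// !mxE; have [_] := ab l.
- exact: cvg_cst.
- apply: cvg_EFin; first exact: nearW.
  rewrite -[X in _ --> X](mulr0 (d%:R : R)).
  by apply: cvgM; [exact: cvg_cst|exact: cvg_harmonic].
Unshelve. all: by end_near. Qed.

End NoStrongProperness.

Theorem corollary1p3 (R : realType) :
  (forall m : nat, (2 <= m)%N ->
     exists F : hyperbolic R m -> euclidean R (6 * m - 6)%N,
       isometric_immersion F /\ proper_map F) /\
  (forall m n : nat, (2 <= m)%N -> (1 <= n)%N ->
     forall F : hyperbolic R m -> euclidean R n,
       isometric_immersion F -> proper_map F -> ~ strongly_proper F).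
Proof.
split; last first.
  by case=> [|[|m]] // n _ _ F isoF _; exact: not_strongly_proper isoF.
case=> [|[|m]] // _.
have -> : (6 * m.+2 - 6 = m.+1 * 6)%N by rewrite mulnC mulSn addKn.
exact: exists_proper_isometric_immersion.
Qed.
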